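(* For the 2-server problem on the line, there exist an online algorithm $A$ and constants $c,c'$ with $c<1$ such that, for every $n$, $\sum_{\sigma\in\mathcal{I}_n}A(\sigma)\le c\sum_{\sigma\in\mathcal{I}_n}\textsc{greedy}(\sigma)+c'$.
   Context: The continuous line $[0,1]$ is modelled by a path whose vertices are equally spaced (all edges of equal, arbitrarily small length). Two servers occupy vertices; a request is a vertex, and an algorithm must move a server to it; the cost is the total distance travelled by the servers. All algorithms start from the same given initial configuration. $\mathcal{I}_n$ is the set of all request sequences of length $n$; $A(\sigma)$ is the cost of $A$ on $\sigma$. $\textsc{greedy}$ serves each request by moving the closest server (only that server moves). *)

(* Defs.v *)
From HB Require Import structures.
From mathcomp Require Import all_boot all_order all_algebra.
From mathcomp Require Export reals.

Set Implicit Arguments.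
Unset Strict Implicit.
Unset Printing Implicit Defensive.

Import Order.TTheory GRing.Theory Num.Theory.
Local Open Scope ring_scope.

(* The vertex i of the path with N edges models the point i / N of [0, 1]. *)
Definition vertex (N : nat) : finType := 'I_N.+1.

Definition dist (R : realType) (N : nat) (x y : vertex N) : R :=
  `|x%:R - y%:R : R| / N%:R.

(* The positions of the first and of the second server, which may coincide. *)
Definition config (N : nat) : Type := (vertex N * vertex N)%type.

Definition move_cost (R : realType) (N : nat) (C D : config N) : R :=
  dist R C.1 D.1 + dist R C.2 D.2.

Definition covers (N : nat) (C : config N) (r : vertex N) : Prop :=
  C.1 = r \/ C.2 = r.

(* [conf p] is the configuration reached once the requests p have been served;
   it depends on no later request, and both servers may move at each step. *)
Record online_alg (N : nat) (C0 : config N) := OnlineAlg {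
  conf :> seq (vertex N) -> config N;
  conf_nil : conf [::] = C0;
  conf_rcons : forall (p : seq (vertex N)) (r : vertex N),
    covers (conf (rcons p r)) r }.

Definition cost (R : realType) (N : nat) (C0 : config N) (A : online_alg C0)
    (s : seq (vertex N)) : R :=
  \sum_(i < size s) move_cost R (A (take i s)) (A (take i.+1 s)).

(* A server at minimal distance serves the request and the other one stays;
   ties between the servers may be broken in any way. *)
Definition is_greedy (R : realType) (N : nat) (C0 : config N)
    (G : online_alg C0) : Prop :=
  forall (p : seq (vertex N)) (r : vertex N),
    let C := G p in
    (dist R C.1 r <= dist R C.2 r /\ G (rcons p r) = (r, C.2)) \/
    (dist R C.2 r <= dist R C.1 r /\ G (rcons p r) = (C.1, r)).

(* Main.v *)
(* Summing over all request sequences amounts to drawing the requests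
   independently and uniformly, so it suffices to beat greedy by a constant
   expected amount, independent of the spacing, in a constant fraction of the
   steps.

   Suppose that greedy's servers are a < b, both near the right end, and that
   the request x lies just left of their midpoint. Greedy moves a to x and keeps
   two servers close to the end; the improved algorithm moves b to x at almost
   the same price. If the next request y is left of a, it serves y with a and is
   ahead by about x - a; keeping its other server at x while greedy's is at b,
   it gains b - a in total if the next request is served by greedy from b, and
   otherwise loses only twice the excess e = a + b - 2x. If y is right of a, it
   returns to greedy's configuration, losing at most about b - a, but this has
   small probability. Three requests later both configurations coincide again.

   Whatever its configuration, greedy reaches such a situation with probability
   bounded below: requests near the points 1, 0, 0.48, 0.72, 0.84, 0.90, 0.93
   pull its left server step by step towards its right one. *)

Require Import Defs.
From mathcomp Require Import all_boot all_order all_algebra.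
From mathcomp Require Import reals lra zify.
Import Order.TTheory GRing.Theory Num.Theory.
Local Open Scope ring_scope.

Set Implicit Arguments.
Unset Strict Implicit.
Unset Printing Implicit Defensive.

(** * Sums over request sequences, costs and vertex counts *)

Lemma sum_tuple_rcons (T : finType) (M : nmodType) (n : nat) (F : seq T -> M) :
  \sum_(s : n.+1.-tuple T) F s = \sum_(s : n.-tuple T) \sum_r F (rcons s r).
Proof.
pose f (u : n.-tuple T * T) := [tuple of rcons u.1 u.2].
pose g (t : n.+1.-tuple T) :=
  ([tuple of belast (thead t) (behead t)], last (thead t) (behead t)).
have fK : cancel f g.
  case=> s r; rewrite /f /g; congr pair; first apply: val_inj => /=.
    by rewrite /thead (tnth_nth r); case: s => -[|x s] //= _; rewrite belast_rcons.
  by rewrite /thead (tnth_nth r); case: s => -[|x s] //= _; rewrite last_rcons.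
have gK : cancel g f.
  move=> t; apply: val_inj => /=; case/tupleP: t => x s.
  by rewrite /thead (tnth_nth x) /= lastI.
rewrite (reindex f) /=; last by exists g => ? _.
by rewrite -(pair_bigA _ (fun s r => F (rcons (tval s) r))).
Qed.

Section Costs.
Variables (R : realType) (N : nat) (C0 : config N).
Implicit Type B : online_alg C0.

Lemma cost_rcons B (s : seq (vertex N)) (r : vertex N) :
  cost R B (rcons s r) = cost R B s + move_cost R (B s) (B (rcons s r)).
Proof.
rewrite /cost size_rcons big_ord_recr /= -!cats1 take_size_cat // take_oversize.
  by congr (_ + _); apply: eq_bigr => i _; rewrite !takel_cat // ltnW.
by rewrite size_cat addn1.
Qed.

Lemma cost_nil B : cost R B [::] = 0.
Proof. by rewrite /cost big_ord0. Qed.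

Lemma vertex_bounds (x : vertex N) : 0 <= x%:R :> R /\ x%:R <= N%:R :> R.
Proof. by rewrite ler0n ler_nat -ltnS ltn_ord. Qed.

Lemma dist_ge0 (x y : vertex N) : 0 <= dist R x y.
Proof. by rewrite /dist divr_ge0. Qed.

(** The integers from [truncn u + 1] to [truncn v] lie in the interval, and their number exceeds
    [v - u - 1]. *)
Lemma count_vertices (u v : R) : 0 <= u -> u <= v -> v <= N%:R ->
  v - u - 1 <= \sum_(x : vertex N) ((u <= x%:R) && (x%:R <= v))%:R.
Proof.
move=> u0 uv vN.
have /andP[u1 u2] := truncn_itv u0.
have /andP[v1 v2] := truncn_itv (le_trans u0 uv).
set k := Num.truncn u in u1 u2; set l := Num.truncn v in v1 v2.
have kl : (k <= l)%N by rewrite -ltnS -(ltr_nat R); apply: le_lt_trans v2; lra.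
have lN : (l.+1 <= N.+1)%N by rewrite ltnS -(ler_nat R); lra.
apply: (@le_trans _ _ (\sum_(k.+1 <= i < l.+1) (1 : R))).
  rewrite big_const_nat iter_addr_0 subSS natrB //.
  move: u2 v2; rewrite -!natr1; lra.
rewrite (big_nat_widen _ _ _ _ _ lN) big_mkcond /= -(big_mkord xpredT
  (fun i => ((u <= i%:R) && (i%:R <= v))%:R : R)) /=.
rewrite (@big_cat_nat _ _ _ k.+1 0 N.+1) //=; last by lia.
rewrite -[leLHS]add0r; apply: lerD; first by apply: sumr_ge0 => i _; rewrite ler0n.
apply: ler_sum_nat => i /andP[ki iN]; case: ifP => il; last by rewrite ler0n.
have -> : u <= i%:R by apply: le_trans (ltW u2) _; rewrite ler_nat.
have -> // : i%:R <= v by apply: le_trans v1; rewrite ler_nat -ltnS.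
Qed.

Hypothesis N_gt0 : (0 < N)%N.

Lemma dist_le1 (x y : vertex N) : dist R x y <= 1.
Proof.
rewrite /dist ler_pdivrMr ?ltr0n // mul1r.
have [? ?] := vertex_bounds x; have [? ?] := vertex_bounds y.
by rewrite ler_norml; apply/andP; split; lra.
Qed.

Lemma move_cost_ge0 (C D : config N) : 0 <= move_cost R C D.
Proof. by rewrite addr_ge0 ?dist_ge0. Qed.

Lemma move_cost_le2 (C D : config N) : move_cost R C D <= 2.
Proof. by rewrite /move_cost; have := dist_le1 C.1 D.1; have := dist_le1 C.2 D.2; lra. Qed.

End Costs.

(** * How often greedy reaches a favourable configuration *)

Section Greedy.
Variables (R : realType) (N : nat) (C0 : config N) (G : online_alg C0).
Hypothesis greedyG : is_greedy R G.
Hypothesis N_large : 10 ^+ 5 <= N%:R :> R.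

Local Notation pos x := ((nat_of_ord x)%:R : R).
Local Notation V := (N.+1%:R : R).

Lemma path_gt0 : (0 < N)%N.
Proof. by rewrite -(ltr_nat R); apply: lt_le_trans N_large; rewrite exprn_gt0. Qed.

Lemma greedy_step (p : seq (vertex N)) (r : vertex N) :
  (`|pos (G p).1 - pos r| <= `|pos (G p).2 - pos r| /\
     G (rcons p r) = (r, (G p).2)) \/
  (`|pos (G p).2 - pos r| <= `|pos (G p).1 - pos r| /\
     G (rcons p r) = ((G p).1, r)).
Proof.
have := greedyG p r.
by rewrite /dist !ler_pM2r ?invr_gt0 ?ltr0n ?path_gt0.
Qed.

Definition spread (l h : R) (C : config N) : bool :=
  [&& 99 / 100 * N%:R <= pos C.2, l <= pos C.1 & pos C.1 <= h] ||
  [&& 99 / 100 * N%:R <= pos C.1, l <= pos C.2 & pos C.2 <= h].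

Definition right_end (C : config N) : bool :=
  (99 / 100 * N%:R <= pos C.1) || (99 / 100 * N%:R <= pos C.2).

(** The request lies right of the left server and strictly left of the midpoint of both, so greedy
    has no tie to break and moves the left server. *)
Lemma spread_step (l h l' h' : R) (p : seq (vertex N)) (r : vertex N) :
  h <= l' -> 2 * h' < l + 99 / 100 * N%:R -> spread l h (G p) ->
  l' <= pos r -> pos r <= h' -> spread l' h' (G (rcons p r)).
Proof.
move=> hl h2 S lr rh.
have [] := greedy_step p r; move: S; rewrite /spread => /orP[] /and3P[b1 l1 h1];
  move=> -[+ ->] /=; rewrite lr rh ?b1 ?orbT //=; repeat case: ger0P => ?; lra.
Qed.

Lemma right_end_step (p : seq (vertex N)) (r : vertex N) :
  99 / 100 * N%:R <= pos r -> right_end (G (rcons p r)).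
Proof.
by move=> rN; rewrite /right_end; have [[_ ->]|[_ ->]] := greedy_step p r;
  rewrite /= rN ?orbT.
Qed.

(** Greedy takes a server away from the right end only if the other one is at least as far right, so
    one always remains there. *)
Lemma spread_init (p : seq (vertex N)) (r : vertex N) :
  right_end (G p) -> 0 <= pos r -> pos r <= 1 / 100 * N%:R ->
  spread 0 (1 / 100 * N%:R) (G (rcons p r)).
Proof.
move=> E r0 rh; have N0 : 0 < N%:R :> R by rewrite ltr0n path_gt0.
have [a0 a1] := vertex_bounds R (G p).1; have [b0 b1] := vertex_bounds R (G p).2.
have [] := greedy_step p r; move: E; rewrite /right_end /spread => E [+ ->] /=;
  rewrite r0 rh !andbT /=; move: E => /orP[] E; rewrite ?E ?orbT //;
  repeat case: ger0P => ?; move=> ?; apply/orP; ((left; lra) || (right; lra)).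
Qed.

(** An interval of length [N / 100] holds at least [N / 100 - 1 >= V / 200] vertices, so the
    transition has probability at least 1/200. *)
Lemma sum_indicator_step (P Q : config N -> bool) (l h : R) :
  0 <= l -> l + 1 / 100 * N%:R <= h -> h <= N%:R ->
  (forall p r, P (G p) -> l <= pos r -> pos r <= h -> Q (G (rcons p r))) ->
  forall n, V / 200 * (\sum_(s : n.-tuple (vertex N)) (P (G s))%:R)
    <= \sum_(s : n.+1.-tuple (vertex N)) (Q (G s))%:R.
Proof.
move=> l0 lh hN PQ n; rewrite (sum_tuple_rcons _ (fun s => (Q (G s))%:R)).
rewrite mulr_sumr; apply: ler_sum => s _.
case: (boolP (P (G s))) => PG; last by rewrite mulr0 sumr_ge0.
rewrite mulr1; have := @count_vertices R N l h l0 _ hN.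
have N0 := N_large.
move=> cnt; apply: (@le_trans _ _ (h - l - 1)).
  by rewrite -natr1; lra.
apply: (le_trans (cnt _)); first by lra.
apply: ler_sum => r _; case: (boolP (_ && _)) => [/andP[lr rh]|_] //=.
by rewrite (PQ _ _ PG lr rh).
Qed.

Lemma good_frequency (n : nat) : (7 <= n)%N ->
  V ^+ n / 200 ^+ 7 <= \sum_(s : n.-tuple (vertex N))
    (spread (93 / 100 * N%:R) (94 / 100 * N%:R) (G s))%:R.
Proof.
move=> n7; rewrite -(subnK n7) addnC; move: (n - 7)%N => m {n n7}.
have N0 := N_large.
(* After [m] arbitrary requests and [k] steered ones, [P] holds with probability at least
   [200 ^- k]. *)
pose often k (P : config N -> bool) := (V / 200) ^+ k * V ^+ m <=
  \sum_(s : (k + m).-tuple (vertex N)) (P (G s))%:R.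
have step k (P Q : config N -> bool) (l h : R) : 0 <= l ->
    l + 1 / 100 * N%:R <= h -> h <= N%:R ->
    (forall p r, P (G p) -> l <= pos r -> pos r <= h -> Q (G (rcons p r))) ->
    often k P -> often k.+1 Q.
  move=> l0 lh hN PQ /(ler_wpM2l _) yP; rewrite /often exprS -mulrA.
  apply: le_trans (sum_indicator_step l0 lh hN PQ (k + m)).
  by apply: yP; rewrite divr_ge0.
have stage k l h l' h' : often k (spread (l * N%:R) (h * N%:R)) ->
    h <= l' -> 2 * h' < l + 99 / 100 -> 0 <= l' -> l' + 1 / 100 <= h' -> h' <= 1 ->
    often k.+1 (spread (l' * N%:R) (h' * N%:R)).
  move=> + hl h2 l0 lh h1; apply: (step _ _ _ (l' * N%:R) (h' * N%:R)); try nra.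
  by move=> p r; apply: spread_step; nra.
have S0 : often 0 xpredT.
  by rewrite /often /= big_const iter_addr_0 card_tuple card_ord natrX mul1r.
have S1 : often 1 right_end.
  apply: (step _ _ _ (99 / 100 * N%:R) N%:R _ _ _ _ S0); [lra.. |].
  by move=> p r _ rN _; apply: right_end_step.
have S2 : often 2 (spread (0 * N%:R) (1 / 100 * N%:R)).
  apply: (step _ _ _ 0 (1 / 100 * N%:R) _ _ _ _ S1); [lra.. |].
  by move=> p r; rewrite mul0r; apply: spread_init.
(* From here on, each target interval ends 1/200 left of the midpoint of the previous lower end and
   99/100. *)
have S3 : often 3 (spread (48 / 100 * N%:R) (49 / 100 * N%:R)).
  by apply: stage S2 _ _ _ _ _; lra.
have S4 : often 4 (spread (72 / 100 * N%:R) (73 / 100 * N%:R)).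
  by apply: stage S3 _ _ _ _ _; lra.
have S5 : often 5 (spread (84 / 100 * N%:R) (85 / 100 * N%:R)).
  by apply: stage S4 _ _ _ _ _; lra.
have S6 : often 6 (spread (90 / 100 * N%:R) (91 / 100 * N%:R)).
  by apply: stage S5 _ _ _ _ _; lra.
have S7 : often 7 (spread (93 / 100 * N%:R) (94 / 100 * N%:R)).
  by apply: stage S6 _ _ _ _ _; lra.
by apply: le_trans S7; rewrite exprMn exprVn exprD mulrAC.
Qed.

End Greedy.

(** * The deviating algorithm and its regret over a block of three requests *)

Section Deviation.
Variables (R : realType) (N : nat) (C0 : config N) (G : online_alg C0).
Hypothesis greedyG : is_greedy R G.
Hypothesis N_large : 10 ^+ 5 <= N%:R :> R.

Local Notation pos x := ((nat_of_ord x)%:R : R).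
Local Notation V := (N.+1%:R : R).
Implicit Types (p q : seq (vertex N)) (C : config N) (u v x y z r : vertex N).

Definition lo C : vertex N := if (C.1 < C.2)%N then C.1 else C.2.
Definition hi C : vertex N := if (C.1 < C.2)%N then C.2 else C.1.

(* Keeping the labels of the servers of C matters, as [move_cost] is labelled. *)
Definition place C u v : config N := if (C.1 < C.2)%N then (u, v) else (v, u).

Lemma place_lo_hi C : place C (lo C) (hi C) = C.
Proof. by rewrite /place /lo /hi; case: C => c1 c2 /=; case: (c1 < c2)%N. Qed.

Lemma move_cost_place C u v u' v' :
  move_cost R (place C u v) (place C u' v') = dist R u u' + dist R v v'.
Proof. by rewrite /place /move_cost; case: ifP => //= _; rewrite addrC. Qed.

Lemma greedy_place C p u v r : G p = place C u v ->
  (`|pos u - pos r| <= `|pos v - pos r| /\ G (rcons p r) = place C r v) \/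
  (`|pos v - pos r| <= `|pos u - pos r| /\ G (rcons p r) = place C u r).
Proof.
have := greedy_step greedyG N_large p r; rewrite /place => + E; rewrite E.
by case: ifP => //= _ []; [right | left].
Qed.

Definition good C : bool := spread (93 / 100 * N%:R : R) (94 / 100 * N%:R) C.

Lemma good_bounds C : good C ->
  [/\ 93 / 100 * N%:R <= pos (lo C), pos (lo C) <= 94 / 100 * N%:R,
      99 / 100 * N%:R <= pos (hi C) & pos (hi C) <= N%:R].
Proof.
have N0 := N_large; rewrite /good /spread /lo /hi -(ltr_nat R).
have [? ?] := vertex_bounds R C.1; have [? ?] := vertex_bounds R C.2.
by case: ltP => ? /orP[] /and3P[? ? ?]; split; lra.
Qed.

Definition gap C : R := pos (hi C) - pos (lo C).
(** Equal to [(hi - x) - (x - lo)]: the extra price of serving [x] with the right server. *)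
Definition excess C x : R := pos (lo C) + pos (hi C) - 2 * pos x.

(** The positive lower bound on the excess forces greedy to move its left server; the upper bound
    keeps the deviation cheap. *)
Definition window C x : bool :=
  [&& good C, gap C / 200 <= excess C x & excess C x <= gap C / 100].

(** Requests are cut into blocks of three, the current one starting at [k]. At block boundaries the
    configuration is that of [G], so regrets of blocks add up. *)
Definition deviation p : config N :=
  let k := (size p - size p %% 3)%N in
  let C := G (take k p) in
  match drop k p with
  | [:: x] => if window C x then place C (lo C) x else G p
  | [:: x; y] => if window C x && (y <= lo C)%N then place C y x else G p
  | _ => G p
  end.

Lemma deviation_nil : deviation [::] = C0.
Proof. by rewrite /deviation /= conf_nil. Qed.

Lemma covers_place C u v r : u = r \/ v = r -> covers (place C u v) r.
Proof. by rewrite /place /covers; case: ifP => //= _ []; [right | left]. Qed.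

Lemma deviation_covers p r : covers (deviation (rcons p r)) r.
Proof.
rewrite /deviation; set k := (_ - _)%N.
have := last_rcons r p r; rewrite -{1}(cat_take_drop k (rcons p r)) last_cat.
case: (drop k _) => [|x [|y [|z t]]] /= E; try exact: conf_rcons.
  by case: ifP => _; [apply: covers_place; right | apply: conf_rcons].
by case: ifP => _; [apply: covers_place; left | apply: conf_rcons].
Qed.

Definition dev_alg : online_alg C0 := OnlineAlg deviation_nil deviation_covers.

Lemma dev_alg_cat q t : (3 %| size q)%N -> (size t < 3)%N ->
  dev_alg (q ++ t) = let C := G q in
  match t with
  | [:: x] => if window C x then place C (lo C) x else G (q ++ t)
  | [:: x; y] => if window C x && (y <= lo C)%N then place C y x else G (q ++ t)
  | _ => G (q ++ t)
  end.
Proof.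
move=> q3 t3; rewrite /= /deviation size_cat.
have -> : (size q + size t - (size q + size t) %% 3)%N = size q.
  by rewrite -modnDml (eqP q3) add0n modn_small // addnK.
by rewrite take_size_cat // drop_size_cat.
Qed.

Definition regret p : R := cost R dev_alg p - cost R G p.

(** Measured in edges. The gap is lost if [y] forces a return to greedy, and gained if [y] is in the
    left half and greedy serves [z] from the right although [z] is left of [x]. The indicators have
    the form counted by [count_vertices]. *)
Definition regret_bound C x y z : R :=
  (window C x)%:R * (2 * excess C x + gap C * (lo C < y)%N%:R
    - gap C * (((0 <= pos y) && (pos y <= N%:R / 2))%:R *
       ((76 / 100 * N%:R <= pos z) && (pos z <= 95 / 100 * N%:R))%:R)).

Lemma regret_block q x y z : (3 %| size q)%N ->
  regret (rcons (rcons (rcons q x) y) z) - regret q <=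
    regret_bound (G q) x y z / N%:R.
Proof.
move=> q3; rewrite /regret !cost_rcons.
have -> : dev_alg (rcons (rcons (rcons q x) y) z) = G (rcons (rcons (rcons q x) y) z).
  have := @dev_alg_cat (rcons (rcons (rcons q x) y) z) [::].
  by rewrite cats0 !size_rcons /= => -> //; rewrite -addn3 dvdn_addl.
have := dev_alg_cat q3 (_ : size [::] < 3)%N; rewrite cats0 => -> //=.
have := dev_alg_cat q3 (_ : size [:: x] < 3)%N; rewrite cats1 => /= -> //.
have := dev_alg_cat q3 (_ : size [:: x; y] < 3)%N.
rewrite -cat1s catA !cats1 => /= -> //.
set C := G q; rewrite /regret_bound.
have N0 := N_large; have N1 : 0 < N%:R :> R by lra.
case: ifP => W; last by rewrite /= !mul0r; lra.
rewrite andTb mul1r.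
have /and3P[/good_bounds[a1 a2 b1 b2]] := W.
rewrite /excess /gap; set a := lo C in a1 a2 *; set b := hi C in b1 b2 *.
move=> e1 e2.
have GC : G q = place C a b by rewrite place_lo_hi.
have Gx : G (rcons q x) = place C x b.
  have [[_ ->] //|[+ _]] := greedy_place x GC.
  by repeat case: ger0P => ?; move=> ?; exfalso; lra.
have N2 : N%:R != 0 :> R by rewrite gt_eqF.
have mC u v : move_cost R C (place C u v) = dist R a u + dist R b v.
  by rewrite -(move_cost_place C) place_lo_hi.
have bx : `|pos b - pos x| = pos b - pos x by rewrite ger0_norm //; lra.
have ax : `|pos a - pos x| = pos x - pos a by rewrite ler0_norm; lra.
rewrite ler_pdivlMr //.
have [ya|ya] := leqP y a; last first.
  rewrite mulr1.
  have -> : (pos y <= N%:R / 2) = false.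
    by apply/negbTE; rewrite -ltNge; move: ya; rewrite -(ltr_nat R); lra.
  rewrite andbF mul0r mulr0 subr0.
  have [g1 [g2 Gy]] : exists g1 g2, G (rcons (rcons q x) y) = place C g1 g2.
    by have [[_ ->]|[_ ->]] := greedy_place y Gx; do 2!eexists.
  rewrite Gx Gy; set last_move := move_cost R (place C g1 g2) _.
  rewrite !mC !move_cost_place /dist !(mulrDl, mulNr, divfK N2) !subrr normr0 bx ax.
  (* Joining greedy costs at most [(x - a) + (b - x)] more than greedy's own move; in total the loss
     is at most [2 (b - x)], which is gap plus excess. *)
  have := ler_distD (pos x) (pos a) (pos g1).
  have := ler_distD (pos b) (pos x) (pos g2).
  by rewrite (distrC (pos x) (pos b)) bx ax; lra.
have {}ya : pos y <= pos a by rewrite ler_nat.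
have ay : `|pos a - pos y| = pos a - pos y by rewrite ger0_norm //; lra.
have xy : `|pos x - pos y| = pos x - pos y by rewrite ger0_norm //; lra.
have Gy : G (rcons (rcons q x) y) = place C y b.
  have [[_ ->] //|[+ _]] := greedy_place y Gx.
  by rewrite xy; case: ger0P => ? ?; exfalso; lra.
rewrite mulr0 addr0; set low := _ && _; set mid := _ && _.
(* The regret so far is the excess minus [x - a]. If greedy serves [z] from [y], bringing [x] back
   to [b] raises it to twice the excess. *)
have [[Zc Gz]|[Zc Gz]] := greedy_place z Gy; rewrite Gx Gy Gz !mC !move_cost_place /dist
  !(mulrDl, mulNr, divfK N2) !subrr normr0 bx ax ay xy.
  have -> : low%:R * mid%:R = 0 :> R.
    rewrite -natrM mulnb; case: (boolP (_ && _)) => //.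
    move=> /andP[/andP[y0 y1] /andP[z0 z1]]; exfalso; move: Zc.
    (* Here [z] is at least [0.26 N] from [y] but at most [0.24 N] from [b], so greedy would use
       [b]. *)
    by rewrite ler0_norm ?ger0_norm; lra.
  by rewrite (distrC (pos x) (pos b)) bx mulr0; lra.
rewrite -natrM mulnb; case: (boolP (_ && _)); rewrite ?mulr0 ?mulr1.
  move=> /andP[/andP[y0 y1] /andP[z0 z1]].
  (* Since [z <= 0.95 N < x], starting from [x] instead of [b] saves [b - x]. *)
  by rewrite (@ger0_norm _ (pos x - pos z)) ?(@ger0_norm _ (pos b - pos z)); lra.
by have := ler_distD (pos b) (pos x) (pos z); rewrite (distrC (pos x) (pos b)) bx; lra.
Qed.

End Deviation.

(** * Averaging the regret over the three requests of a block *)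

Section Averages.
Variables (R : realType) (N : nat) (C0 : config N) (G : online_alg C0).
Hypothesis greedyG : is_greedy R G.
Hypothesis N_large : 10 ^+ 5 <= N%:R :> R.

Local Notation pos x := ((nat_of_ord x)%:R : R).
Local Notation V := (N.+1%:R : R).
Implicit Types (q : seq (vertex N)) (C : config N) (x y z : vertex N).

Lemma sum_const (c : R) : \sum_(x : vertex N) c = V * c.
Proof. by rewrite sumr_const card_ord mulr_natl. Qed.

(** Per unit of gap, the average is at most about [0.02 + 0.07 - 0.5 * 0.19 = -0.005]. Weakening
    this to [-0.004] absorbs lower-order terms, and the gap is at least [N / 20]. *)
Lemma window_sum C x : window R C x ->
  \sum_y \sum_z regret_bound R C x y z <= - (N%:R * V ^+ 2 / 10 ^+ 4).
Proof.
move=> W; have N0 := N_large.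
have /and3P[/(good_bounds N_large)[a1 a2 b1 b2] e1 e2] := W.
set w := gap R C in e1 e2; set e := excess R C x in e1 e2.
pose i y := ((lo C < y)%N%:R : R).
pose j y := (((0 <= pos y) && (pos y <= N%:R / 2))%:R : R).
pose k z := (((76 / 100 * N%:R <= pos z) && (pos z <= 95 / 100 * N%:R))%:R : R).
have -> : \sum_y \sum_z regret_bound R C x y z =
    V * (V * (2 * e)) + w * V * (\sum_y i y) - w * ((\sum_y j y) * (\sum_z k z)).
  rewrite -(sum_const (V * (2 * e))) mulr_suml !mulr_sumr -big_split -sumrB /=.
  apply: eq_bigr => y _; rewrite !mulr_sumr -!sum_const.
  rewrite -mulrA mulrCA -sum_const -big_split -sumrB /=.
  by apply: eq_bigr => z _; rewrite /regret_bound W mul1r.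
have jge : N%:R / 2 - 1 <= \sum_y j y.
  by have := @count_vertices R N 0 (N%:R / 2); rewrite subr0; apply; lra.
have kge : 19 / 100 * N%:R - 1 <= \sum_z k z.
  apply: (@le_trans _ _ (95 / 100 * N%:R - 76 / 100 * N%:R - 1)); first lra.
  by apply: count_vertices; lra.
have ile : \sum_y i y <= 7 / 100 * N%:R + 2.
  have := @count_vertices R N 0 (pos (lo C)) _ _ _.
  (* Vertex counts are bounded only from below, so the complement is counted. *)
  have -> : \sum_y i y = V - \sum_(y : vertex N) ((0 <= pos y) && (pos y <= pos (lo C)))%:R.
    rewrite -[V]mulr1 -sum_const -sumrB; apply: eq_bigr => y _.
    rewrite /i ler0n ler_nat ltnNge /=; case: (y <= lo C)%N => /=; lra.
  move=> /(_ _ _ _) H; have {H} := H ltac:(lra) ltac:(lra) ltac:(lra).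
  by rewrite -natr1; lra.
have w5 : 5 / 100 * N%:R <= w by rewrite /w /gap; lra.
have jk : (N%:R / 2 - 1) * (19 / 100 * N%:R - 1) <= (\sum_y j y) * (\sum_z k z).
  by apply: ler_pM; lra.
set I := \sum_y i y in ile *; set J := (\sum_y j y) * _ in jk *; rewrite -natr1.
set n := N%:R in N0 ile jk w5 *.
have w0 : 0 <= w by lra.
have n1 : 0 <= n + 1 by lra.
have t1 : 2 * e <= w / 50 by lra.
have {}t1 := ler_wpM2l (sqr_ge0 (n + 1)) t1.
have t2 : w * (n + 1) * I <= w * ((n + 1) * (7 / 100 * n + 2)).
  by rewrite -mulrA; apply: ler_wpM2l => //; apply: ler_wpM2l.
have t3 : w * ((n / 2 - 1) * (19 / 100 * n - 1)) <= w * J by apply: ler_wpM2l.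
have t4 : (n + 1) ^+ 2 / 50 + (n + 1) * (7 / 100 * n + 2)
    - (n / 2 - 1) * (19 / 100 * n - 1) <= - (4 / 1000 * n ^+ 2).
  by nra.
have {}t4 := ler_wpM2l w0 t4.
have t5 : 5 / 100 * n * (4 / 1000 * n ^+ 2) <= w * (4 / 1000 * n ^+ 2).
  by apply: ler_wpM2r => //; rewrite mulr_ge0 ?sqr_ge0 //; lra.
have t6 : n * (n + 1) ^+ 2 <= n * (2 * n ^+ 2) by apply: ler_wpM2l; nra.
by lra.
Qed.

(** The window is an interval of length [gap / 400], hence at least [N / 8000]. *)
Lemma window_count C : good R C ->
  V / 10 ^+ 5 <= \sum_x (window R C x)%:R.
Proof.
move=> gC; have N0 := N_large; have [a1 a2 b1 b2] := good_bounds N_large gC.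
pose m := pos (lo C) + pos (hi C); pose w := gap R C.
apply: (@le_trans _ _ ((m - w / 200) / 2 - (m - w / 100) / 2 - 1)).
  by rewrite -natr1 /w /gap; lra.
have cnt := @count_vertices R N ((m - w / 100) / 2) ((m - w / 200) / 2).
apply: (le_trans (cnt _ _ _)); [rewrite /m /w /gap; lra .. |].
apply: ler_sum => x _; case: (boolP (_ && _)) => //= /andP[h1 h2].
have -> // : window R C x; rewrite /window gC -/w /excess -/m /=; lra.
Qed.

(** At least [V / 10^5] choices of [x] each gain [V^2 / 10^4]; all other choices leave the regret
    bound at 0. *)
Lemma regret_block_sum q : (3 %| size q)%N ->
  \sum_x \sum_y \sum_z regret R G (rcons (rcons (rcons q x) y) z) <=
    V ^+ 3 * regret R G q - (good R (G q))%:R * (V ^+ 3 / 10 ^+ 9).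
Proof.
move=> q3; have N0 := N_large; have N1 : 0 < N%:R :> R by lra.
apply: (@le_trans _ _ (\sum_x \sum_y \sum_z
    (regret R G q + regret_bound R (G q) x y z / N%:R))).
  do 3!(apply: ler_sum => ? _).
  by rewrite -lerBlDl; apply: regret_block.
have -> : \sum_x \sum_y \sum_z (regret R G q + regret_bound R (G q) x y z / N%:R)
  = V ^+ 3 * regret R G q + (\sum_x \sum_y \sum_z regret_bound R (G q) x y z) / N%:R.
  rewrite mulr_suml !exprS expr0 mulr1 -!mulrA -sum_const -big_split.
  apply: eq_bigr => x _; rewrite mulr_suml -sum_const -big_split.
  apply: eq_bigr => y _; rewrite mulr_suml -sum_const -big_split.
  by apply: eq_bigr.
rewrite lerD2l ler_pdivrMr //.
case: (boolP (good R (G q))) => gC; last first.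
  rewrite mul0r oppr0 mul0r; do 3!(apply: sumr_le0 => ? _).
  by rewrite /regret_bound /window (negbTE gC) mul0r.
apply: (@le_trans _ _ (\sum_x (window R (G q) x)%:R * - (N%:R * V ^+ 2 / 10 ^+ 4))).
  apply: ler_sum => x _; case: (boolP (window R (G q) x)) => W.
    by rewrite mul1r; apply: window_sum.
  rewrite mul0r; do 2!(apply: sumr_le0 => ? _).
  by rewrite /regret_bound (negbTE W) mul0r.
rewrite -mulr_suml mul1r mulrN mulNr lerN2.
have K0 : 0 <= N%:R * V ^+ 2 / 10 ^+ 4 by rewrite !mulr_ge0 ?invr_ge0 ?exprn_ge0.
apply: le_trans (ler_wpM2r K0 (window_count gC)).
by lra.
Qed.

End Averages.

(** * Linear decrease of the average regret *)

Section Drift.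
Variables (R : realType) (N : nat) (C0 : config N) (G : online_alg C0).
Hypothesis greedyG : is_greedy R G.
Hypothesis N_large : 10 ^+ 5 <= N%:R :> R.

Local Notation V := (N.+1%:R : R).
Local Notation total n F := (\sum_(s : n.-tuple (vertex N)) F (tval s)).

(** Expected gain per block: [10^-9] from a good configuration, times the frequency [200^-7] of such
    configurations. *)
Definition drift : R := 1 / 10 ^+ 9 / 200 ^+ 7.

(** This upper bound on greedy's cost turns a constant gain per request into a ratio below 1. *)
Lemma total_cost_le (n : nat) : total n (cost R G) <= 2 * n%:R * V ^+ n.
Proof.
have N1 := path_gt0 N_large.
elim: n => [|n IH].
  rewrite mulr0 mul0r; apply: sumr_le0 => s _.
  by rewrite tuple0 cost_nil.
rewrite sum_tuple_rcons exprS.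
apply: (@le_trans _ _ (V * (total n (cost R G) + 2 * V ^+ n))).
  rewrite mulrDr !mulr_sumr; have -> : V ^+ n = total n (fun=> 1).
    by rewrite big_const iter_addr_0 card_tuple card_ord natrX.
  rewrite !mulr_sumr -big_split; apply: ler_sum => s _ /=.
  rewrite mulr1 -mulrDr -sum_const; apply: ler_sum => r _.
  by rewrite cost_rcons lerD2l; apply: move_cost_le2.
rewrite [leRHS]mulrCA ler_wpM2l // -natr1; lra.
Qed.

Lemma total_regret_step (n : nat) :
  total n.+1 (regret R G) <= V * total n (regret R G) + 2 * V ^+ n.+1.
Proof.
have N1 := path_gt0 N_large.
rewrite sum_tuple_rcons exprS mulrCA -mulrDr.
have -> : V ^+ n = total n (fun=> 1).
  by rewrite big_const iter_addr_0 card_tuple card_ord natrX.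
rewrite mulr_sumr -big_split mulr_sumr; apply: ler_sum => s _ /=.
rewrite mulr1 -sum_const; apply: ler_sum => r _; rewrite /regret !cost_rcons.
have := move_cost_le2 R N1 (dev_alg R G s) (dev_alg R G (rcons s r)).
have := move_cost_ge0 R (G s) (G (rcons s r)); lra.
Qed.

Lemma total_regret_block (n : nat) : (7 <= n)%N -> (3 %| n)%N ->
  total n.+3 (regret R G) <= V ^+ 3 * (total n (regret R G) - drift * V ^+ n).
Proof.
move=> n7 n3; rewrite sum_tuple_rcons.
rewrite (sum_tuple_rcons _ (fun s => \sum_z regret R G (rcons s z))).
rewrite (sum_tuple_rcons _ (fun s => \sum_y \sum_z regret R G (rcons (rcons s y) z))).
apply: (@le_trans _ _ (V ^+ 3 * total n (regret R G) - V ^+ 3 / 10 ^+ 9 *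
    total n (fun s => (good R (G s))%:R))).
  rewrite !mulr_sumr -sumrB; apply: ler_sum => s _.
  rewrite [_ / _ * _]mulrC; apply: regret_block_sum => //.
  by rewrite size_tuple.
rewrite mulrBr lerD2l lerN2.
have K0 : 0 <= V ^+ 3 / 10 ^+ 9 by rewrite divr_ge0 ?exprn_ge0.
apply: le_trans (ler_wpM2l K0 (good_frequency greedyG N_large n7)).
by rewrite /drift; lra.
Qed.

Lemma total_regret_le (n : nat) :
  total n (regret R G) <= (30 - drift / 3 * n%:R) * V ^+ n.
Proof.
have k0 : 0 <= drift by rewrite /drift; lra.
have k1 : drift <= 1 by rewrite /drift; lra.
have V0 k : 0 <= V ^+ k by rewrite exprn_ge0.
have step k c : total k (regret R G) <= c * V ^+ k ->
    total k.+1 (regret R G) <= (c + 2) * V ^+ k.+1.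
  move=> H; apply: le_trans (total_regret_step k) _.
  by rewrite [(c + 2) * _]mulrDl lerD2r exprS mulrCA ler_wpM2l.
have S0 : total 0 (regret R G) <= 0 * V ^+ 0.
  by rewrite mul0r sumr_le0 // => s _; rewrite tuple0 /regret !cost_nil subrr.
have lin k : total k (regret R G) <= (2 * k%:R) * V ^+ k.
  elim: k => [|k /step]; first by rewrite mulr0.
  by rewrite -(@natr1 R k) mulrDr mulr1.
(* The gain needs seven earlier requests, so up to three blocks are bounded crudely by [2 * 9 = 18];
   the term [3 * drift] makes up for their missing gains. *)
have triple m :
    total (3 * m) (regret R G) <= (18 + 3 * drift - drift * m%:R) * V ^+ (3 * m).
  elim: m => [|m IH]; first by apply: (le_trans S0); rewrite mulr0 mul0r; nra.
  have [m3|m3] := leqP m.+1 3.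
    apply: (le_trans (lin _)); apply: ler_wpM2r => //.
    have : m.+1%:R <= 3 :> R by rewrite ler_nat.
    by rewrite natrM; nra.
  rewrite mulnS addnC addn3; apply: (le_trans (total_regret_block _ _)).
  - by lia.
  - by rewrite dvdn_mulr.
  rewrite -(addn3 (3 * m)) addnC exprD mulrCA ler_wpM2l // -(@natr1 R m).
  by move: IH; lra.
have [r3 En] : (n %% 3 < 3)%N /\ n = (3 * (n %/ 3) + n %% 3)%N.
  by rewrite ltn_mod mulnC -divn_eq.
move: (n %/ 3)%N (n %% 3)%N r3 En => m r r3 ->.
have H := triple m.
have c2 x y (k : nat) : x <= y -> x * V ^+ k <= y * V ^+ k by apply: ler_wpM2r.
(* An incomplete last block adds at most 4, which the constant 30 accommodates. *)
case: r r3 => [|[|[|//]]] _; rewrite ?addn0 ?addn1 ?addn2.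
- by apply: le_trans H (c2 _ _ _ _); rewrite natrM; lra.
- by apply: le_trans (step _ _ H) (c2 _ _ _ _); rewrite -(@natr1 R (3 * m)) natrM; lra.
- apply: le_trans (step _ _ (step _ _ H)) (c2 _ _ _ _).
  by rewrite -(@natr1 R (3 * m).+1) -(@natr1 R (3 * m)) natrM; lra.
Qed.

End Drift.

(** * Choice of constants and comparison with greedy *)

Theorem theorem5 (R : realType) :
  exists c : R, c < 1 /\
  exists N0 : nat, forall N : nat, (N0 <= N)%N ->
  forall (C0 : config N) (G : online_alg C0), is_greedy R G ->
  exists (A : online_alg C0) (c' : R), forall n : nat,
    \sum_(s : n.-tuple (vertex N)) cost R A s
      <= c * (\sum_(s : n.-tuple (vertex N)) cost R G s) + c'.
Proof.
set k : R := drift R.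
have k0 : 0 < k by rewrite /k /drift; lra.
(* Greedy's total is at most [2 n V^n], so giving up [k / 12] of it uses half of the gain
   [k / 3 * n]. *)
exists (1 - k / 12); split; first by lra.
exists (10 ^ 5)%N => N; rewrite -(ler_nat R) natrX => N_large C0 G greedyG.
(* From [n1] on, [30 - k / 6 * n] is nonpositive; shorter sequences are covered by the additive
   constant. *)
have [n1 n1P] : exists n1 : nat, 180 <= k * n1%:R.
  exists (Num.truncn (180 / k)).+1; rewrite mulrC -ler_pdivrMr //.
  by have /andP[_ /ltW] := truncn_itv (ltW (divr_gt0 (ltr0n _ 180) k0)).
exists (dev_alg R G), (30 * N.+1%:R ^+ n1) => n.
have := total_regret_le greedyG N_large n; rewrite sumrB.
have := total_cost_le G N_large n; rewrite -/k.
set SG := \sum_(s : n.-tuple _) cost R G s.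
set SA := \sum_(s : n.-tuple _) cost R (dev_alg R G) s.
have V1 : 1 <= N.+1%:R :> R by rewrite ler1n.
set P := N.+1%:R ^+ n; have P0 : 0 <= P by rewrite exprn_ge0.
have Pn1 : 0 <= N.+1%:R ^+ n1 :> R by rewrite exprn_ge0.
move=> HG HA.
have kG := ler_wpM2l (ltW k0) HG.
suff : (30 - k / 6 * n%:R) * P <= 30 * N.+1%:R ^+ n1 by lra.
have [n1n|nn1] := leqP n1 n.
  apply: (@le_trans _ _ 0); last by rewrite mulr_ge0.
  apply: mulr_le0_ge0 => //.
  have : k * n1%:R <= k * n%:R by rewrite ler_pM2l ?ler_nat.
  by lra.
apply: (@le_trans _ _ (30 * P)).
  apply: ler_wpM2r => //; have : 0 <= k * n%:R by rewrite mulr_ge0 // ltW.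
  by lra.
by rewrite ler_wpM2l // ler_weXn2l // ltnW.
Qed.
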